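(* For any $d,a_0,\ldots,a_d\in\mathbb{N}_0$ and $c_1,\ldots,c_d\in\mathbb{N}\setminus\{2\}$ with $c_1\ge3$ if $a_0=0$ and $d\ge1$, putting $c_0=1$, $c_{d+1}=0$, $\delta_i=\delta(c_i)+\delta(c_{i+1})$, $k_{-1}=0$, $$t^{\star}(\{2\}^{a_0},c_1,\{2\}^{a_1},\ldots,c_d,\{2\}^{a_d})=\frac{2}{\pi}\sum_{k_0\geq k_1\geq\cdots\geq k_d\geq1}\prod_{i=0}^{d}\frac{(-1)^{k_i\delta_i}}{(2k_i-1)^{2a_i-\delta_i+3}}V_{k_{i-1},k_i}^{\#}(\{1\}^{c_i-3}).$$
   Context: For an index $\boldsymbol{s}=(s_1,\ldots,s_r)$ of positive integers with $s_1>1$ (or empty), $t^{\star}(\boldsymbol{s})=\sum_{k_1\geq\cdots\geq k_r\geq1}\prod_{j=1}^r(2k_j-1)^{-s_j}$, $t^\star(\emptyset)=1$. $\{s\}^a$ denotes $s$ repeated $a$ times; for $a\le0$, $\{1\}^a$ is empty. $\triangle(k,m)=0$ if $k=m$, $1$ otherwise. For an index $\boldsymbol{s}=(s_1,\ldots,s_r)$ and $k,m\in\mathbb{N}_0$: if $\boldsymbol{s}\ne\emptyset$ and $k\ge m$, $V^{\#}_{k,m}(\boldsymbol{s})=\frac{2k-1}{2m-1}\sum_{k\geq l_1\geq\cdots\geq l_r\geq m}\frac{2^{\triangle(k,l_1)+\triangle(l_1,l_2)+\cdots+\triangle(l_r,m)}}{(2l_1-1)^{s_1}\cdots(2l_r-1)^{s_r}}$;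 otherwise $V^{\#}_{k,m}(\boldsymbol{s})=\left(2\cdot\frac{2k-1}{2m-1}\right)^{\triangle(k,m)}$. $\delta(0)=2$, $\delta(1)=1$, $\delta(c)=0$ for $c\ge3$. *)

(* Defs.v *)
From Stdlib Require Import Reals List Arith ZArith.
Import ListNotations.
Open Scope R_scope.

(* 2k-1 as a real number (for k = 0 this is -1). *)
Definition oddR (k : nat) : R := 2 * INR k - 1.

Definition sum_range (lo hi : nat) (g : nat -> R) : R :=
  fold_right (fun k acc => g k + acc) 0 (seq lo (S hi - lo)).

Fixpoint chsum (n hi lo : nat) (f : list nat -> R) : R :=
  match n with
  | O => f []
  | S n' => sum_range lo hi (fun k => chsum n' k lo (fun ks => f (k :: ks)))
  end.

Fixpoint tterm (s ks : list nat) : R :=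
  match s, ks with
  | sj :: s', kj :: ks' => / (oddR kj ^ sj) * tterm s' ks'
  | _, _ => 1
  end.

Definition tstar_part (s : list nat) (N : nat) : R :=
  chsum (length s) N 1 (tterm s).

Definition tri (k m : nat) : nat := if Nat.eqb k m then 0%nat else 1%nat.

Fixpoint trich (prev : nat) (ls : list nat) (m : nat) : nat :=
  match ls with
  | [] => tri prev m
  | l :: ls' => (tri prev l + trich l ls' m)%nat
  end.

Definition Vsharp (k m : nat) (s : list nat) : R :=
  match s with
  | [] => (2 * (oddR k / oddR m)) ^ (tri k m)
  | _ :: _ =>
      if Nat.leb m k then
        oddR k / oddR m *
        chsum (length s) k m (fun ls => 2 ^ (trich k ls m) * tterm s ls)
      else (2 * (oddR k / oddR m)) ^ (tri k m)
  end.

(* delta(0)=2, delta(1)=1, delta(c)=0 for c>=3 (value at 2 irrelevant) *)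
Definition deltaf (c : nat) : nat :=
  match c with O => 2%nat | 1%nat => 1%nat | _ => 0%nat end.

Definition index_of (d : nat) (a c : nat -> nat) : list nat :=
  repeat 2%nat (a O) ++ concat (map (fun i => c i :: repeat 2%nat (a i)) (seq 1 d)).

Definition cext (d : nat) (c : nat -> nat) (i : nat) : nat :=
  if Nat.eqb i 0 then 1%nat else if Nat.leb i d then c i else 0%nat.

Definition deltai (d : nat) (c : nat -> nat) (i : nat) : nat :=
  (deltaf (cext d c i) + deltaf (cext d c (S i)))%nat.

Definition rfactor (d : nat) (a c : nat -> nat) (i prev k : nat) : R :=
  (-1) ^ (k * deltai d c i)
  / powerRZ (oddR k) (2 * Z.of_nat (a i) - Z.of_nat (deltai d c i) + 3)%Z
  * Vsharp prev k (repeat 1%nat (cext d c i - 3)).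

Fixpoint rprod (d : nat) (a c : nat -> nat) (i prev : nat) (ks : list nat) : R :=
  match ks with
  | [] => 1
  | k :: ks' => rfactor d a c i prev k * rprod d a c (S i) k ks'
  end.

Definition rhs_part (d : nat) (a c : nat -> nat) (N : nat) : R :=
  chsum (S d) N 1 (rprod d a c 0 0).

(* Main.v *)
Require Import Defs.
From Stdlib Require Import Reals List Arith ZArith Lra Lia.
Import ListNotations.
Open Scope R_scope.

(** Let [w(n,k) = 4 ((1/2)_n)^2 / ((n-k)! (n+k-1)!)].  It satisfies
    [w(n,k) - w(n-1,k) = ((2k-1)/(2n-1))^2 w(n,k)] and
    [(n-k) w(n,k) = (n+k) w(n,k+1)].  If the truncation at [n] of a t-star value is
    [sum_(k<=n) w(n,k) F(k)], then prepending an entry to the index changes [F] as follows: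
    - the entry 2 divides [F(k)] by [(2k-1)^2];
    - the entry 1 gives [(2p-1)^-1 sum_(k<=p) 2^tri(p,k) F(k)];
    - an entry [c >= 3] gives [(2p-1)^-2 (M^(c-2) F)(p)], where
      [(M F)(p) = sum_(k<=p) (-1)^(p-k) 2^tri(p,k) F(k)/(2k-1)].
    Starting from [1 = sum_(k<=n) w(n,k) (-1)^(k-1)/(2k-1)] for the empty index, this
    yields a finite version of the identity, in which the outermost sum carries the weight
    [w(N,k_0)].  As [w(N,k)] is decreasing in [k] and its differences in [k] tend to 0 as
    [N] grows, Abel summation turns the weight into its limit [lim w(N,1)], provided
    that the sum of the [F(k)] converges; this follows from [F(k) = O(k^(-3/2))], or from
    Leibniz' series for the empty index.  The latter case also shows that the limit is
    [4/PI]. *)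

(** * Odd numbers and signs *)

Lemma oddR_pos k : (1 <= k)%nat -> 0 < oddR k.
Proof. intros H. apply le_INR in H. simpl in H. unfold oddR. lra. Qed.

Lemma oddR_ge k : (1 <= k)%nat -> INR k <= oddR k.
Proof. intros H. apply le_INR in H. simpl in H. unfold oddR. lra. Qed.

Lemma oddR_S k : oddR (S k) = oddR k + 2.
Proof. unfold oddR. rewrite S_INR. ring. Qed.

Lemma INR_gt0 k : (1 <= k)%nat -> 0 < INR k.
Proof. intros H. apply lt_0_INR. lia. Qed.

Lemma tri_refl k : tri k k = 0%nat.
Proof. unfold tri. now rewrite Nat.eqb_refl. Qed.

Lemma tri_neq k m : k <> m -> tri k m = 1%nat.
Proof. intros H. unfold tri. apply Nat.eqb_neq in H. now rewrite H. Qed.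

Lemma pow_m1_double k : (-1) ^ (k * 2) = 1.
Proof. rewrite Nat.mul_comm, pow_1_even. reflexivity. Qed.

Lemma pow_m1_sqr k : (-1) ^ k * (-1) ^ k = 1.
Proof. rewrite <- pow_add, <- (pow_m1_double k). f_equal. lia. Qed.

(** * Sums *)

Lemma sum_range_empty lo hi g : (hi < lo)%nat -> sum_range lo hi g = 0.
Proof.
  intros H. unfold sum_range. replace (S hi - lo)%nat with O by lia. reflexivity.
Qed.

Lemma sum_range_S lo hi g : (lo <= S hi)%nat ->
  sum_range lo (S hi) g = sum_range lo hi g + g (S hi).
Proof.
  intros H. unfold sum_range.
  replace (S (S hi) - lo)%nat with (S (S hi - lo)) by lia.
  rewrite seq_S, fold_right_app. cbn [fold_right].
  replace (lo + (S hi - lo))%nat with (S hi) by lia.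
  induction (seq lo (S hi - lo)) as [|x l IH]; cbn [fold_right]; [ring | rewrite IH; ring].
Qed.

Lemma sum_range_ext lo hi f g :
  (forall k, (lo <= k <= hi)%nat -> f k = g k) -> sum_range lo hi f = sum_range lo hi g.
Proof.
  intros H. unfold sum_range.
  assert (K : forall k, In k (seq lo (S hi - lo)) -> f k = g k).
  { intros k Hk. apply in_seq in Hk. apply H. lia. }
  induction (seq lo (S hi - lo)) as [|x l IH]; simpl; [reflexivity|].
  rewrite (K x) by now left. rewrite IH; [reflexivity|]. intros. apply K. now right.
Qed.

Lemma sum_range_plus lo hi f g :
  sum_range lo hi (fun k => f k + g k) = sum_range lo hi f + sum_range lo hi g.
Proof.
  unfold sum_range. induction (seq lo (S hi - lo)) as [|x l IH]; simpl; [ring|].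
  rewrite IH. ring.
Qed.

Lemma sum_range_scal lo hi c f :
  sum_range lo hi (fun k => c * f k) = c * sum_range lo hi f.
Proof.
  unfold sum_range. induction (seq lo (S hi - lo)) as [|x l IH]; simpl; [ring|].
  rewrite IH. ring.
Qed.

Lemma sum_range_abs_le lo hi f g :
  (forall k, (lo <= k <= hi)%nat -> Rabs (f k) <= g k) ->
  Rabs (sum_range lo hi f) <= sum_range lo hi g.
Proof.
  intros H. unfold sum_range.
  assert (K : forall k, In k (seq lo (S hi - lo)) -> Rabs (f k) <= g k).
  { intros k Hk. apply in_seq in Hk. apply H. lia. }
  induction (seq lo (S hi - lo)) as [|x l IH]; simpl; [rewrite Rabs_R0; lra|].
  eapply Rle_trans; [apply Rabs_triang|].
  apply Rplus_le_compat; [apply K; now left|]. apply IH. intros. apply K. now right.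
Qed.

Lemma sum_range_triangle n (f : nat -> nat -> R) :
  sum_range 1 n (fun l => sum_range 1 l (fun k => f l k)) =
  sum_range 1 n (fun k => sum_range k n (fun l => f l k)).
Proof.
  induction n as [|n IH]; [now rewrite !sum_range_empty by lia|].
  rewrite !sum_range_S, IH by lia.
  rewrite (sum_range_ext 1 n (fun k => sum_range k (S n) (fun l => f l k))
    (fun k => sum_range k n (fun l => f l k) + f (S n) k))
    by (intros; apply sum_range_S; lia).
  rewrite sum_range_plus, (sum_range_empty (S n) n) by lia.
  change (fun k : nat => f (S n) k) with (f (S n)). ring.
Qed.

Lemma chsum_ext n : forall hi lo f g, (forall ks, f ks = g ks) ->
  chsum n hi lo f = chsum n hi lo g.
Proof.
  induction n as [|n IH]; intros hi lo f g H; simpl; [apply H|].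
  apply sum_range_ext. intros k _. apply IH. intros; apply H.
Qed.

Lemma chsum_scal n : forall hi lo c f,
  chsum n hi lo (fun ks => c * f ks) = c * chsum n hi lo f.
Proof.
  induction n as [|n IH]; intros hi lo c f; simpl; [reflexivity|].
  rewrite <- sum_range_scal. apply sum_range_ext. intros k _. apply IH.
Qed.

Lemma tstar_part_cons s0 s N :
  tstar_part (s0 :: s) N = sum_range 1 N (fun n => / oddR n ^ s0 * tstar_part s n).
Proof.
  unfold tstar_part. simpl. apply sum_range_ext. intros k _. apply chsum_scal.
Qed.

(** * The kernel *)

(** The weight [w(n,1) = 4 ((1/2)_n)^2 / ((n-1)! n!)], a partial product of Wallis type. The value 0
    at [n = 0] makes all weights vanish there. *)
Fixpoint kernel0 (n : nat) : R :=
  match n with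
  | O => 0
  | S O => 1
  | S (S _ as m) => kernel0 m * (oddR (S m) ^ 2 / (4 * INR m * INR (S m)))
  end.

(* The step from [k'] is trivial at [k' = 0], hence [kernel n 1 = kernel0 n].
   In closed form [kernel n k = 4 ((1/2)_n)^2 / ((n - k)! (n + k - 1)!)] for
   [1 <= k <= n], and [kernel n k = 0] for [k > n]. *)
Fixpoint kernel (n k : nat) : R :=
  match k with
  | O => kernel0 n
  | S k' => kernel n k' * ((INR n - INR k') / (INR n + INR k'))
  end.

Lemma kernel_1 n : kernel n 1 = kernel0 n.
Proof.
  destruct n; [simpl; ring|]. pose proof (INR_gt0 (S n) ltac:(lia)).
  cbn [kernel]. change (INR 0) with 0. field. lra.
Qed.

Lemma kernel_ratio n k : (1 <= n)%nat ->
  (INR n - INR k) * kernel n k = (INR n + INR k) * kernel n (S k).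
Proof.
  intros H. pose proof (INR_gt0 n H). pose proof (pos_INR k).
  cbn [kernel]. field. lra.
Qed.

Lemma kernel_gt n k : (n < k)%nat -> kernel n k = 0.
Proof.
  induction 1 as [|k H IH]; cbn [kernel]; [|rewrite IH; ring].
  unfold Rdiv. rewrite Rminus_diag. ring.
Qed.

(** Rests on [(2n+1)^2 - (2k-1)^2 = 4 (n+1-k) (n+k)]: in closed form the quotient of the two kernels
    is [(n+1-k) (n+k) / (n+1/2)^2]. *)
Lemma kernel_step n k : (1 <= k)%nat ->
  kernel n k * oddR (S n) ^ 2 =
  kernel (S n) k * (oddR (S n) ^ 2 - oddR k ^ 2).
Proof.
  intros H. destruct n as [|n].
  { rewrite kernel_gt by lia. inversion H; subst.
    - unfold oddR. simpl. ring.
    - rewrite kernel_gt by lia. ring. }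
  induction H as [|k H IH].
  - rewrite !kernel_1. pose proof (INR_gt0 (S n) ltac:(lia)).
    cbn [kernel0]. unfold oddR. rewrite (S_INR (S n)). change (INR 1) with 1.
    field. lra.
  - pose proof (INR_gt0 (S n) ltac:(lia)). pose proof (pos_INR k).
    cbn [kernel]. unfold oddR in *. rewrite !S_INR in *.
    replace (kernel (S n) k * ((INR n + 1 - INR k) / (INR n + 1 + INR k)) * (2 * (INR n + 1 + 1) - 1) ^ 2)
      with (kernel (S n) k * (2 * (INR n + 1 + 1) - 1) ^ 2 * ((INR n + 1 - INR k) / (INR n + 1 + INR k))) by ring.
    rewrite IH. field. lra.
Qed.

Lemma kernel_nonneg n k : 0 <= kernel n k.
Proof.
  destruct (Nat.lt_ge_cases n k) as [H|H]; [rewrite kernel_gt; [lra|lia]|].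
  induction k as [|k IH].
  - cbn [kernel]. clear H. induction n as [|n IH]; [simpl; lra|].
    destruct n as [|n]; [simpl; lra|]. cbn [kernel0] in *.
    apply Rmult_le_pos; [exact IH|].
    pose proof (INR_gt0 (S n) ltac:(lia)). pose proof (INR_gt0 (S (S n)) ltac:(lia)).
    apply Rlt_le, Rdiv_lt_0_compat; [apply pow_lt, oddR_pos; lia|].
    repeat apply Rmult_lt_0_compat; lra.
  - cbn [kernel]. apply Rmult_le_pos; [apply IH; lia|].
    pose proof (INR_gt0 n ltac:(lia)). pose proof (pos_INR k).
    assert (INR k <= INR n) by (apply le_INR; lia).
    apply Rmult_le_pos; [lra|]. apply Rlt_le, Rinv_0_lt_compat. lra.
Qed.

Lemma kernel_diff n k : (1 <= n)%nat ->
  kernel n k - kernel n (S k) = kernel n k * (2 * INR k / (INR n + INR k)).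
Proof.
  intros H. pose proof (INR_gt0 n H). pose proof (pos_INR k).
  cbn [kernel]. field. lra.
Qed.

Lemma kernel_decr n k : (1 <= n)%nat -> kernel n (S k) <= kernel n k.
Proof.
  intros H. pose proof (INR_gt0 n H). pose proof (pos_INR k).
  pose proof (kernel_diff n k H).
  assert (0 <= kernel n k * (2 * INR k / (INR n + INR k))); [|lra].
  apply Rmult_le_pos; [apply kernel_nonneg|].
  apply Rmult_le_pos; [lra|]. apply Rlt_le, Rinv_0_lt_compat. lra.
Qed.

Lemma kernel0_bound n : kernel0 n <= 2.
Proof.
  destruct n as [|n]; [simpl; lra|].
  (* The bound 2 alone would not survive a growth factor above 1; the slack [1 / n] pays for it. *)
  assert (H : kernel0 (S n) <= 2 - / INR (S n)).
  { induction n as [|n IH]; [simpl; lra|].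
    pose proof (INR_gt0 (S n) ltac:(lia)) as P.
    cbn [kernel0] in *. unfold oddR. rewrite (S_INR (S n)).
    set (x := INR (S n)) in *.
    eapply Rle_trans; [apply Rmult_le_compat_r; [|exact IH]|].
    - apply Rlt_le, Rdiv_lt_0_compat; [nra|]. repeat apply Rmult_lt_0_compat; lra.
    - apply Rminus_le.
      replace (_ - _) with (- ((2 * x + 1) / (4 * x ^ 2 * (x + 1)))) by (field; lra).
      apply Ropp_le_cancel. rewrite Ropp_0, Ropp_involutive.
      apply Rlt_le, Rdiv_lt_0_compat; [lra|].
      repeat apply Rmult_lt_0_compat; nra. }
  pose proof (Rinv_0_lt_compat _ (INR_gt0 (S n) ltac:(lia))). lra.
Qed.

Lemma kernel0_growing : Un_growing kernel0.
Proof.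
  intros n. destruct n as [|n]; [simpl; lra|].
  rewrite <- !kernel_1.
  pose proof (kernel_step (S n) 1 ltac:(lia)) as E.
  pose proof (kernel_nonneg (S (S n)) 1). pose proof (kernel_nonneg (S n) 1).
  assert (1 < oddR (S (S n))).
  { pose proof (INR_gt0 (S n) ltac:(lia)). rewrite oddR_S. unfold oddR. lra. }
  change (oddR 1) with (2 * 1 - 1) in E.
  assert (0 < oddR (S (S n)) ^ 2) by nra. nra.
Qed.

Lemma kernel_bound n k : kernel n k <= 2.
Proof.
  destruct n as [|n].
  - destruct k; [simpl; lra|]. rewrite kernel_gt by lia. lra.
  - induction k as [|k IH]; [apply kernel0_bound|].
    eapply Rle_trans; [apply kernel_decr; lia | exact IH].
Qed.

Lemma kernel_diff_cv k : Un_cv (fun n => kernel n k - kernel n (S k)) 0.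
Proof.
  intros eps He.
  (* As [kernel n k <= 2], the difference is at most [4 k / (n + k)], which this [K] brings below
     [eps]. *)
  destruct (INR_unbounded (4 * INR k / eps)) as [K HK].
  exists (S K). intros n Hn. unfold R_dist. rewrite Rminus_0_r.
  pose proof (pos_INR k). pose proof (INR_gt0 n ltac:(lia)).
  assert (INR K <= INR n) by (apply le_INR; lia).
  rewrite kernel_diff by lia.
  pose proof (kernel_nonneg n k). pose proof (kernel_bound n k).
  assert (Q : 0 <= 2 * INR k / (INR n + INR k)).
  { apply Rmult_le_pos; [lra|]. apply Rlt_le, Rinv_0_lt_compat. lra. }
  rewrite Rabs_pos_eq by now apply Rmult_le_pos.
  apply Rle_lt_trans with (2 * (2 * INR k / (INR n + INR k)));
    [apply Rmult_le_compat_r; lra|].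
  apply Rmult_lt_reg_r with (INR n + INR k); [lra|].
  replace (2 * (2 * INR k / (INR n + INR k)) * (INR n + INR k)) with (4 * INR k) by (field; lra).
  assert (4 * INR k < INR n * eps); [|nra].
  replace (4 * INR k) with (4 * INR k / eps * eps) by (field; lra).
  apply Rmult_lt_compat_r; lra.
Qed.

(** * Summation against the kernel *)

Lemma sum_range_abel m (w F : nat -> R) :
  sum_range 1 m (fun k => w k * F k) =
  sum_range 1 m (fun k => (w k - w (S k)) * sum_range 1 k F) + w (S m) * sum_range 1 m F.
Proof.
  induction m as [|m IH]; [rewrite !sum_range_empty by lia; ring|].
  rewrite !sum_range_S, IH by lia. ring.
Qed.

Lemma sum_range_telescope m (w : nat -> R) :
  sum_range 1 m (fun k => w k - w (S k)) = w 1%nat - w (S m).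
Proof.
  induction m as [|m IH]; [rewrite sum_range_empty by lia; ring|].
  rewrite sum_range_S, IH by lia. ring.
Qed.

Lemma kernel_diff_sum_cv0 m (g : nat -> R) :
  Un_cv (fun n => sum_range 1 m (fun k => (kernel n k - kernel n (S k)) * g k)) 0.
Proof.
  induction m as [|m IH].
  - intros eps He. exists O. intros n _. rewrite sum_range_empty by lia.
    unfold R_dist. rewrite Rminus_0_r, Rabs_R0. exact He.
  - assert (C : Un_cv (fun n => sum_range 1 m (fun k => (kernel n k - kernel n (S k)) * g k)
        + (kernel n (S m) - kernel n (S (S m))) * g (S m)) (0 + 0 * g (S m))).
    { apply CV_plus; [exact IH|].
      apply (CV_mult (fun n => kernel n (S m) - kernel n (S (S m))) (fun _ => g (S m)));
        [apply kernel_diff_cv|].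
      intros eps He. exists O. intros. unfold R_dist. rewrite Rminus_diag, Rabs_R0. exact He. }
    rewrite Rmult_0_l, Rplus_0_r in C.
    intros eps He. destruct (C eps He) as [K HK]. exists K. intros n Hn.
    rewrite sum_range_S by lia. exact (HK n Hn).
Qed.

(** Toeplitz' argument: for each [n] the weights are nonnegative with total at most 2, and each
    fixed weight tends to 0 as [n] grows. *)
Lemma kernel_toeplitz0 (g : nat -> R) : Un_cv g 0 ->
  Un_cv (fun n => sum_range 1 n (fun k => (kernel n k - kernel n (S k)) * g k)) 0.
Proof.
  intros Hg eps He.
  destruct (Hg (eps / 4) ltac:(lra)) as [K HK].
  destruct (kernel_diff_sum_cv0 K g (eps / 4) ltac:(lra)) as [K' HK'].
  exists (S (K + K')). intros n Hn.
  specialize (HK' n ltac:(lia)). unfold R_dist in *. rewrite Rminus_0_r in *.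
  (* Beyond [K] the weights telescope, so the tail costs at most [eps / 4 * 2]; with the head this
     stays below [eps]. *)
  assert (H : forall m, (K <= m)%nat ->
    Rabs (sum_range 1 m (fun k => (kernel n k - kernel n (S k)) * g k)) <=
    Rabs (sum_range 1 K (fun k => (kernel n k - kernel n (S k)) * g k))
    + eps / 4 * (kernel n (S K) - kernel n (S m))).
  { induction 1 as [|m Hm IH]; [lra|].
    rewrite sum_range_S by lia.
    eapply Rle_trans; [apply Rabs_triang|]. rewrite Rabs_mult.
    pose proof (kernel_decr n (S m) ltac:(lia)).
    rewrite (Rabs_pos_eq (kernel n (S m) - _)) by lra.
    specialize (HK (S m) ltac:(lia)). rewrite Rminus_0_r in HK. nra. }
  specialize (H n ltac:(lia)).
  pose proof (kernel_bound n (S K)). pose proof (kernel_nonneg n (S n)). nra.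
Qed.

Lemma kernel0_cv : exists l, Un_cv kernel0 l.
Proof.
  destruct (growing_cv kernel0 kernel0_growing) as [l Hl]; [|now exists l].
  exists 2. intros x [n ->]. apply kernel0_bound.
Qed.

(** Abel summation turns the left side into a weighted sum of the partial sums of [F]. After
    subtracting [r] from these, the rest is [r] times the total weight [kernel0 n]. The limit [l]
    stays abstract until Leibniz' series determines it. *)
Lemma kernel_toeplitz (F : nat -> R) r l :
  Un_cv kernel0 l -> Un_cv (fun n => sum_range 1 n F) r ->
  Un_cv (fun n => sum_range 1 n (fun k => kernel n k * F k)) (l * r).
Proof.
  intros Hl Hr.
  assert (C : Un_cv (fun n =>
    sum_range 1 n (fun k => (kernel n k - kernel n (S k)) * (sum_range 1 k F - r))
    + kernel0 n * r) (0 + l * r)).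
  { apply CV_plus.
    - apply (kernel_toeplitz0 (fun k => sum_range 1 k F - r)).
      intros eps He. destruct (Hr eps He) as [K HK]. exists K. intros n Hn.
      unfold R_dist. rewrite Rminus_0_r. exact (HK n Hn).
    - apply (CV_mult kernel0 (fun _ => r)); [exact Hl|].
      intros eps He. exists O. intros. unfold R_dist. rewrite Rminus_diag, Rabs_R0. exact He. }
  rewrite Rplus_0_l in C.
  intros eps He. destruct (C eps He) as [K HK]. exists K. intros n Hn.
  replace (sum_range 1 n (fun k => kernel n k * F k)) with
    (sum_range 1 n (fun k => (kernel n k - kernel n (S k)) * (sum_range 1 k F - r))
    + kernel0 n * r); [exact (HK n Hn)|].
  rewrite (sum_range_abel n (kernel n)), kernel_gt, <- kernel_1 by lia.
  rewrite (sum_range_ext 1 n _ (fun k => (kernel n k - kernel n (S k)) * sum_range 1 k F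
    + - r * (kernel n k - kernel n (S k)))) by (intros; ring).
  rewrite sum_range_plus, sum_range_scal, sum_range_telescope, (kernel_gt n (S n)) by lia.
  ring.
Qed.

(** Summation by parts: up to [m], the two sides differ by a boundary term with the factor [n - m],
    which vanishes at [m = n]. Taking [h = alt_sum F] divides a kernel sum by [2n-1]; read
    backwards, with [F = oddR * double_sum h], it multiplies one by [2n-1]. *)
Lemma kernel_sum_div n (F h : nat -> R) : (1 <= n)%nat ->
  h 1%nat = F 1%nat / oddR 1 ->
  (forall p, (1 <= p)%nat -> h (S p) + h p = F (S p) / oddR (S p) - F p / oddR p) ->
  sum_range 1 n (fun k => kernel n k * h k) =
  / oddR n * sum_range 1 n (fun k => kernel n k * F k).
Proof.
  intros Hn H1 HS. pose proof (oddR_pos n Hn) as Pn.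
  assert (H : forall m, (1 <= m)%nat ->
    oddR n * sum_range 1 m (fun k => kernel n k * h k)
    - sum_range 1 m (fun k => kernel n k * F k)
    = (INR n - INR m) * kernel n m * (h m + F m / oddR m)).
  { induction 1 as [|m Hm IH].
    - rewrite !sum_range_S, !sum_range_empty, H1 by lia.
      unfold oddR. change (INR 1) with 1. field.
    - rewrite !sum_range_S by lia. specialize (HS m Hm).
      pose proof (oddR_pos (S m) ltac:(lia)) as Pm.
      assert (EF : F (S m) = F (S m) / oddR (S m) * oddR (S m)) by (field; lra).
      set (f' := F (S m) / oddR (S m)) in *. set (f := F m / oddR m) in *.
      replace (h (S m)) with (f' - f - h m) by lra.
      (* This moves the boundary term onto [kernel n (S m)], the weight of the new summand. *)
      rewrite kernel_ratio in IH by lia. rewrite EF.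
      set (A := sum_range 1 m (fun k => kernel n k * h k)) in *.
      set (B := sum_range 1 m (fun k => kernel n k * F k)) in *.
      transitivity ((oddR n * A - B) + kernel n (S m) * (oddR n * (f' - f - h m) - f' * oddR (S m)));
        [ring|].
      rewrite IH. unfold oddR. rewrite !S_INR. ring. }
  specialize (H n Hn). replace (INR n - INR n) with 0 in H by ring.
  rewrite !Rmult_0_l in H.
  apply Rmult_eq_reg_l with (oddR n); [|lra].
  rewrite <- Rmult_assoc, Rinv_r, Rmult_1_l by lra. lra.
Qed.

(** By [kernel_step], [(w(N+1,k) - w(N,k)) / (2k-1)^2 = w(N+1,k) / (2N+1)^2], so the sum over [n]
    telescopes for each [k]. *)
Lemma kernel_sum_sqr N (F : nat -> R) :
  sum_range 1 N (fun n => / oddR n ^ 2 * sum_range 1 n (fun k => kernel n k * F k)) =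
  sum_range 1 N (fun k => kernel N k * (F k / oddR k ^ 2)).
Proof.
  induction N as [|N IH]; [now rewrite !sum_range_empty by lia|].
  rewrite sum_range_S, IH by lia.
  replace (sum_range 1 N (fun k => kernel N k * (F k / oddR k ^ 2))) with
    (sum_range 1 (S N) (fun k => kernel N k * (F k / oddR k ^ 2)))
    by (rewrite sum_range_S, (kernel_gt N (S N)) by lia; ring).
  rewrite <- sum_range_scal, <- sum_range_plus. apply sum_range_ext. intros k Hk.
  pose proof (kernel_step N k ltac:(lia)) as E.
  pose proof (oddR_pos k ltac:(lia)). pose proof (oddR_pos (S N) ltac:(lia)).
  apply Rmult_eq_reg_r with (oddR (S N) ^ 2); [|apply pow_nonzero; lra].
  transitivity (kernel N k * oddR (S N) ^ 2 * (F k / oddR k ^ 2) + kernel (S N) k * F k);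
    [field; lra|].
  rewrite E. field. lra.
Qed.

(** * Effect of prepending an entry to the index *)

Definition double_sum (F : nat -> R) (p : nat) : R :=
  sum_range 1 p (fun k => 2 ^ tri p k * F k).

(** The operator [M] of the overview; [p + k] has the parity of [p - k]. *)
Definition alt_sum (F : nat -> R) (p : nat) : R :=
  sum_range 1 p (fun k => 2 ^ tri p k * ((-1) ^ (p + k) * (F k / oddR k))).

Lemma sum_range_tri p (g : nat -> R) : (1 <= p)%nat ->
  sum_range 1 p (fun k => 2 ^ tri p k * g k) = 2 * sum_range 1 p g - g p.
Proof.
  intros H. destruct p as [|p]; [lia|].
  rewrite !sum_range_S, tri_refl by lia.
  rewrite (sum_range_ext 1 p _ (fun k => 2 * g k))
    by (intros; rewrite tri_neq by lia; ring).
  rewrite sum_range_scal. simpl. ring.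
Qed.

Lemma double_sum_1 F : double_sum F 1 = F 1%nat.
Proof. unfold double_sum. rewrite sum_range_tri, sum_range_S, sum_range_empty by lia. ring. Qed.

Lemma double_sum_S F p : (1 <= p)%nat ->
  double_sum F (S p) - double_sum F p = F (S p) + F p.
Proof.
  intros H. unfold double_sum. rewrite !sum_range_tri, sum_range_S by lia. ring.
Qed.

Lemma alt_sum_1 F : alt_sum F 1 = F 1%nat / oddR 1.
Proof.
  unfold alt_sum.
  rewrite (sum_range_tri 1 (fun k => (-1) ^ (1 + k) * (F k / oddR k))) by lia.
  rewrite sum_range_S, sum_range_empty by lia. simpl. ring.
Qed.

Lemma alt_sum_S F p : (1 <= p)%nat ->
  alt_sum F (S p) + alt_sum F p = F (S p) / oddR (S p) - F p / oddR p.
Proof.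
  intros H. unfold alt_sum.
  rewrite (sum_range_tri (S p) (fun k => (-1) ^ (S p + k) * (F k / oddR k))) by lia.
  rewrite (sum_range_tri p (fun k => (-1) ^ (p + k) * (F k / oddR k))) by lia.
  rewrite sum_range_S by lia.
  rewrite (sum_range_ext 1 p _ (fun k => -1 * ((-1) ^ (p + k) * (F k / oddR k))))
    by (intros; cbn [Nat.add pow]; ring).
  rewrite sum_range_scal, !pow_add, !pow_m1_sqr. ring.
Qed.

(** At [N = 0] the empty index would give 1 on the left and 0 on the right. *)
Definition represents (s : list nat) (F : nat -> R) : Prop :=
  forall N, (1 <= N)%nat ->
  tstar_part s N = sum_range 1 N (fun k => kernel N k * F k).

Lemma represents_ext s F G : (forall k, (1 <= k)%nat -> F k = G k) ->
  represents s F -> represents s G.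
Proof.
  intros E H N HN. rewrite (H N HN). apply sum_range_ext. intros k Hk.
  rewrite E by lia. reflexivity.
Qed.

(** By [kernel_step], passing from [N] to [N + 1] changes the sum by [(2N+1)^-2] times the sum of
    [w(N+1,k) (-1)^(k-1) (2k-1)], and the latter sum is 0. *)
Lemma represents_nil : represents [] (fun k => - (-1) ^ k / oddR k).
Proof.
  intros N HN. unfold tstar_part. cbn [length chsum tterm]. symmetry.
  induction HN as [|N HN IH].
  { rewrite sum_range_S, sum_range_empty, kernel_1 by lia. simpl. unfold oddR. simpl. field. }
  (* The partial sums have a closed form with the factor [N + 1 - m], which vanishes at the end of
     the range. *)
  assert (Z : forall m, (1 <= m)%nat ->
    INR N * sum_range 1 m (fun k => kernel (S N) k * (- (-1) ^ k * oddR k)) =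
    - (-1) ^ m * INR m * ((INR (S N) - INR m) * kernel (S N) m)).
  { induction 1 as [|m Hm IHm].
    - rewrite sum_range_S, sum_range_empty by lia.
      unfold oddR. rewrite (S_INR N). change (INR 1) with 1. cbn [pow]. ring.
    - rewrite sum_range_S, Rmult_plus_distr_l, IHm, kernel_ratio by lia.
      unfold oddR. rewrite !S_INR. cbn [pow]. ring. }
  specialize (Z (S N) ltac:(lia)).
  replace (INR (S N) - INR (S N)) with 0 in Z by ring.
  rewrite Rmult_0_l, Rmult_0_r in Z.
  apply Rmult_integral in Z. pose proof (INR_gt0 N HN). destruct Z as [Z|Z]; [lra|].
  rewrite <- IH.
  replace (sum_range 1 N (fun k => kernel N k * (- (-1) ^ k / oddR k))) with
    (sum_range 1 (S N) (fun k => kernel N k * (- (-1) ^ k / oddR k)))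
    by (rewrite sum_range_S, (kernel_gt N (S N)) by lia; ring).
  pose proof (oddR_pos (S N) ltac:(lia)).
  transitivity (sum_range 1 (S N) (fun k => kernel N k * (- (-1) ^ k / oddR k))
    + / oddR (S N) ^ 2 * sum_range 1 (S N) (fun k => kernel (S N) k * (- (-1) ^ k * oddR k)));
    [|rewrite Z; ring].
  rewrite <- sum_range_scal, <- sum_range_plus. apply sum_range_ext. intros k Hk.
  pose proof (kernel_step N k ltac:(lia)) as E. pose proof (oddR_pos k ltac:(lia)).
  apply Rmult_eq_reg_r with (oddR (S N) ^ 2); [|apply pow_nonzero; lra].
  transitivity (kernel N k * oddR (S N) ^ 2 * (- (-1) ^ k / oddR k) + kernel (S N) k * (- (-1) ^ k * oddR k));
    [|field; lra].
  rewrite E. field. lra.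
Qed.

(** Write [(2n-1)^-1] as [(2n-1)^-2 (2n-1)]: [kernel_sum_div], read backwards, absorbs the factor
    [2n-1], and [kernel_sum_sqr] performs the summation over [n]. *)
Lemma represents_cons_one s F : represents s F ->
  represents (1%nat :: s) (fun p => double_sum F p / oddR p).
Proof.
  intros H N HN. rewrite tstar_part_cons.
  rewrite (sum_range_ext 1 N _ (fun n => / oddR n ^ 2 *
    sum_range 1 n (fun k => kernel n k * (oddR k * double_sum F k)))).
  - rewrite kernel_sum_sqr. apply sum_range_ext. intros k Hk.
    pose proof (oddR_pos k ltac:(lia)). field. lra.
  - intros n Hn. pose proof (oddR_pos n ltac:(lia)).
    rewrite H, (kernel_sum_div n (fun k => oddR k * double_sum F k) F) by
      (try lia; try (intros p Hp; pose proof (oddR_pos p Hp);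
        pose proof (oddR_pos (S p) ltac:(lia)); rewrite <- double_sum_S by lia; field; lra);
       pose proof (oddR_pos 1 ltac:(lia)); rewrite double_sum_1; field; lra).
    field. lra.
Qed.

Lemma kernel_sum_div_pow j F n : (1 <= n)%nat ->
  / oddR n ^ j * sum_range 1 n (fun k => kernel n k * F k) =
  sum_range 1 n (fun k => kernel n k * Nat.iter j alt_sum F k).
Proof.
  intros Hn. pose proof (oddR_pos n Hn). induction j as [|j IH]; [simpl; field|].
  cbn [pow]. change (Nat.iter (S j) alt_sum F) with (alt_sum (Nat.iter j alt_sum F)).
  rewrite (kernel_sum_div n (Nat.iter j alt_sum F) (alt_sum (Nat.iter j alt_sum F)))
    by (try exact Hn; try apply alt_sum_1; intros; now apply alt_sum_S).
  rewrite <- IH. field. split; [apply pow_nonzero|]; lra.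
Qed.

(** Of the [j + 2] inverse powers of [2n-1], [j] are absorbed by [alt_sum] one at a time; the last
    two serve the summation over [n]. The case [j = 0] is the entry 2. *)
Lemma represents_cons_ge2 j s F : represents s F ->
  represents (S (S j) :: s) (fun p => Nat.iter j alt_sum F p / oddR p ^ 2).
Proof.
  intros H N HN. rewrite tstar_part_cons, <- kernel_sum_sqr.
  apply sum_range_ext. intros n Hn. pose proof (oddR_pos n ltac:(lia)).
  rewrite H, <- kernel_sum_div_pow by lia. cbn [pow]. field.
  split; [apply pow_nonzero|]; lra.
Qed.

Lemma represents_twos m s F : represents s F ->
  represents (repeat 2%nat m ++ s) (fun p => F p / oddR p ^ (2 * m)).
Proof.
  intros H. induction m as [|m IH].
  - apply (represents_ext s F); [intros; simpl; field|exact H].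
  - cbn [repeat app]. eapply represents_ext; [|apply (represents_cons_ge2 0), IH].
    intros k Hk. pose proof (oddR_pos k Hk). cbn [Nat.iter nat_rect].
    replace (2 * S m)%nat with (2 * m + 2)%nat by lia.
    rewrite (pow_add _ (2 * m) 2). generalize (pow_nonzero (oddR k) (2 * m) ltac:(lra)).
    generalize (oddR k ^ (2 * m)). intros. field. lra.
Qed.

(** * Growth of the coefficients *)

Lemma sum_inv_sqrt n : sum_range 1 n (fun k => / sqrt (INR k)) <= 2 * sqrt (INR n).
Proof.
  induction n as [|n IH]; [rewrite sum_range_empty by lia; simpl; rewrite sqrt_0; lra|].
  rewrite sum_range_S by lia.
  pose proof (pos_INR n). pose proof (INR_gt0 (S n) ltac:(lia)).
  pose proof (sqrt_lt_R0 _ H0). pose proof (sqrt_pos (INR n)).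
  assert (E1 := sqrt_sqrt _ H). assert (E2 := sqrt_sqrt (INR (S n)) ltac:(lra)).
  rewrite S_INR in E2 at 3.
  set (x := sqrt (INR n)) in *. set (y := sqrt (INR (S n))) in *.
  apply Rle_trans with (2 * x + / y); [lra|].
  apply Rmult_le_reg_r with y; [lra|].
  (* Since [y^2 = x^2 + 1], the claim [2xy + 1 <= 2y^2] is [(y - x)^2 >= 0]. *)
  replace ((2 * x + / y) * y) with (2 * x * y + 1) by (field; lra). nra.
Qed.

(** Comparison with 1 plus the integral of [t^(-3/2)] from 1 to [n]. *)
Lemma sum_inv_cube_sqrt n : (1 <= n)%nat ->
  sum_range 1 n (fun k => / (INR k * sqrt (INR k))) <= 3 - 2 / sqrt (INR n).
Proof.
  induction 1 as [|n Hn IH].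
  { rewrite sum_range_S, sum_range_empty by lia. simpl. rewrite sqrt_1. lra. }
  rewrite sum_range_S by lia.
  pose proof (INR_gt0 n Hn). pose proof (INR_gt0 (S n) ltac:(lia)).
  pose proof (sqrt_lt_R0 _ H). pose proof (sqrt_lt_R0 _ H0).
  assert (E1 := sqrt_sqrt (INR n) ltac:(lra)).
  assert (E2 := sqrt_sqrt (INR (S n)) ltac:(lra)).
  set (x := sqrt (INR n)) in *. set (y := sqrt (INR (S n))) in *.
  assert (E3 : y * y = x * x + 1) by (rewrite E1, E2; apply S_INR).
  rewrite <- E2. enough (/ (y * y * y) <= 2 / x - 2 / y) by lra.
  assert (x < y) by nra.
  apply Rminus_le.
  replace (/ (y * y * y) - (2 / x - 2 / y)) with
    ((x - 2 * (y * y) * (y - x)) / (x * y * y * y)) by (field; lra).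
  apply Rmult_le_reg_r with (x * y * y * y); [repeat apply Rmult_lt_0_compat; lra|].
  unfold Rdiv. rewrite Rmult_assoc, Rinv_l, Rmult_0_l, Rmult_1_r
    by (repeat apply Rmult_integral_contrapositive_currified; lra).
  assert (E4 : (y - x) * (x + y) = 1) by lra.
  apply Rmult_le_reg_r with (x + y); [lra|].
  replace ((x - 2 * (y * y) * (y - x)) * (x + y)) with
    (x * (x + y) - 2 * (y * y) * ((y - x) * (x + y))) by ring.
  rewrite E4. nra.
Qed.

(** With [g] the bounding sequence, [g] and [F + g] are nonnegative and at most [2 g], so both
    series converge by monotonicity; subtract them. *)
Lemma summable_of_bound (F : nat -> R) C : 0 <= C ->
  (forall k, (1 <= k)%nat -> Rabs (F k) <= C * / (INR k * sqrt (INR k))) ->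
  exists r, Un_cv (fun n => sum_range 1 n F) r.
Proof.
  intros HC H.
  set (g := fun k => C * / (INR k * sqrt (INR k))).
  assert (Hg : forall k, (1 <= k)%nat -> 0 <= g k).
  { intros k Hk. eapply Rle_trans; [apply Rabs_pos | apply (H k Hk)]. }
  assert (Bg : forall n, sum_range 1 n g <= 3 * C).
  { intros n. unfold g. rewrite sum_range_scal. destruct n as [|n].
    - rewrite sum_range_empty by lia. lra.
    - pose proof (sum_inv_cube_sqrt (S n) ltac:(lia)).
      pose proof (Rinv_0_lt_compat _ (sqrt_lt_R0 _ (INR_gt0 (S n) ltac:(lia)))). nra. }
  assert (CV : forall f : nat -> R, (forall k, (1 <= k)%nat -> 0 <= f k <= 2 * g k) ->
    exists r, Un_cv (fun n => sum_range 1 n f) r).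
  { intros f Hf. destruct (growing_cv (fun n => sum_range 1 n f)) as [r Hr]; [| |now exists r].
    - intros n. rewrite sum_range_S by lia. specialize (Hf (S n) ltac:(lia)). lra.
    - exists (2 * (3 * C)). intros x [n ->].
      apply Rle_trans with (Rabs (sum_range 1 n f)); [apply Rle_abs|].
      apply Rle_trans with (sum_range 1 n (fun k => 2 * g k)).
      + apply sum_range_abs_le. intros k Hk. specialize (Hf k ltac:(lia)).
        rewrite Rabs_pos_eq; lra.
      + rewrite sum_range_scal. specialize (Bg n). lra. }
  destruct (CV g) as [r1 H1]; [intros k Hk; specialize (Hg k Hk); lra|].
  destruct (CV (fun k => F k + g k)) as [r2 H2].
  { intros k Hk. specialize (H k Hk). fold (g k) in H. 
    pose proof (Rle_abs (F k)). pose proof (Rle_abs (- F k)) as L.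
    rewrite Rabs_Ropp in L. lra. }
  exists (r2 - r1). pose proof (CV_minus _ _ _ _ H2 H1) as H3.
  intros eps He. destruct (H3 eps He) as [K HK]. exists K. intros n Hn.
  specialize (HK n Hn). rewrite sum_range_plus in HK.
  replace (sum_range 1 n F) with (sum_range 1 n F + sum_range 1 n g - sum_range 1 n g) by ring.
  exact HK.
Qed.

Lemma sum_tri_bound p (g h : nat -> R) :
  (forall k, (1 <= k <= p)%nat -> Rabs (g k) <= h k) ->
  Rabs (sum_range 1 p (fun k => 2 ^ tri p k * g k)) <= 2 * sum_range 1 p h.
Proof.
  intros H. rewrite <- sum_range_scal. apply sum_range_abs_le. intros k Hk.
  rewrite Rabs_mult. pose proof (Rabs_pos (g k)). specialize (H k Hk).
  assert (Rabs (2 ^ tri p k) <= 2).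
  { rewrite Rabs_pos_eq by (apply pow_le; lra). unfold tri. destruct (Nat.eqb p k); simpl; lra. }
  pose proof (Rabs_pos (2 ^ tri p k)). nra.
Qed.

Lemma inv_oddR_le k : (1 <= k)%nat -> / oddR k <= / INR k.
Proof.
  intros H. apply Rinv_le_contravar; [now apply INR_gt0 | now apply oddR_ge].
Qed.

Lemma sqrt_mul_inv k : (1 <= k)%nat -> sqrt (INR k) * / INR k = / sqrt (INR k).
Proof.
  intros H. pose proof (INR_gt0 k H) as P. pose proof (sqrt_lt_R0 _ P).
  rewrite <- (sqrt_sqrt (INR k)) at 2 by lra. field. lra.
Qed.

(** The exponents [-1/2] here and [1/2] in [moderate] absorb the logarithms that a bound [O(1/k)]
    would pick up at each summation: summing [k^(-1/2)] gives [O(k^(1/2))], and dividing by [2k-1]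
    leads back. *)
Definition decays (F : nat -> R) : Prop :=
  exists C, 0 <= C /\ forall k, (1 <= k)%nat -> Rabs (F k) <= C * / sqrt (INR k).

Definition moderate (F : nat -> R) : Prop :=
  exists C, 0 <= C /\ forall k, (1 <= k)%nat -> Rabs (F k) <= C * sqrt (INR k).

Lemma decays_ext F G : (forall k, (1 <= k)%nat -> F k = G k) -> decays F -> decays G.
Proof.
  intros E [C [HC H]]. exists C. split; [exact HC|]. intros k Hk.
  rewrite <- E by exact Hk. now apply H.
Qed.

Lemma sqrt_ge1 k : (1 <= k)%nat -> 1 <= sqrt (INR k).
Proof.
  intros H. rewrite <- sqrt_1. apply sqrt_le_1_alt. now apply (le_INR 1).
Qed.

Lemma decays_moderate F : decays F -> moderate F.
Proof.
  intros [C [HC H]]. exists C. split; [exact HC|]. intros k Hk.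
  eapply Rle_trans; [now apply H|]. apply Rmult_le_compat_l; [exact HC|].
  pose proof (sqrt_ge1 k Hk). apply Rle_trans with 1; [|lra].
  rewrite <- Rinv_1. apply Rinv_le_contravar; lra.
Qed.

Lemma decays_double_sum F : decays F -> decays (fun p => double_sum F p / oddR p).
Proof.
  intros [C [HC H]]. exists (4 * C). split; [lra|]. intros p Hp.
  pose proof (oddR_pos p Hp). pose proof (INR_gt0 p Hp).
  unfold Rdiv. rewrite Rabs_mult, (Rabs_pos_eq (/ oddR p))
    by (apply Rlt_le, Rinv_0_lt_compat; lra).
  assert (B : Rabs (double_sum F p) <= 4 * C * sqrt (INR p)).
  { eapply Rle_trans; [apply (sum_tri_bound p F (fun k => C * / sqrt (INR k)))|].
    - intros k Hk. apply H. lia.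
    - rewrite sum_range_scal. pose proof (sum_inv_sqrt p). nra. }
  rewrite <- (sqrt_mul_inv p Hp), <- Rmult_assoc.
  apply Rmult_le_compat; [apply Rabs_pos| |exact B|now apply inv_oddR_le].
  apply Rlt_le, Rinv_0_lt_compat; lra.
Qed.

Lemma moderate_alt_sum F : moderate F -> moderate (alt_sum F).
Proof.
  intros [C [HC H]]. exists (4 * C). split; [lra|]. intros p Hp.
  eapply Rle_trans; [apply (sum_tri_bound p _ (fun k => C * / sqrt (INR k)))|].
  - intros k Hk. pose proof (oddR_pos k ltac:(lia)).
    rewrite Rabs_mult, pow_1_abs, Rmult_1_l. unfold Rdiv.
    rewrite Rabs_mult, (Rabs_pos_eq (/ oddR k)) by (apply Rlt_le, Rinv_0_lt_compat; lra).
    rewrite <- sqrt_mul_inv, <- Rmult_assoc by lia.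
    apply Rmult_le_compat; [apply Rabs_pos| |apply H; lia|apply inv_oddR_le; lia].
    apply Rlt_le, Rinv_0_lt_compat; lra.
  - rewrite sum_range_scal. pose proof (sum_inv_sqrt p). nra.
Qed.

Lemma moderate_iter_alt_sum j F : moderate F -> moderate (Nat.iter j alt_sum F).
Proof. intros H. induction j as [|j IH]; [exact H | apply moderate_alt_sum, IH]. Qed.

Lemma moderate_div_sqr F : moderate F ->
  exists C, 0 <= C /\ forall k, (1 <= k)%nat ->
  Rabs (F k / oddR k ^ 2) <= C * / (INR k * sqrt (INR k)).
Proof.
  intros [C [HC H]]. exists C. split; [exact HC|]. intros k Hk.
  pose proof (oddR_pos k Hk). pose proof (INR_gt0 k Hk). pose proof (sqrt_ge1 k Hk).
  assert (P : 0 < / oddR k ^ 2) by (apply Rinv_0_lt_compat, pow_lt; lra).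
  unfold Rdiv. rewrite Rabs_mult, (Rabs_pos_eq (/ _)) by lra.
  rewrite Rinv_mult, <- (sqrt_mul_inv k Hk).
  replace (C * (/ INR k * (sqrt (INR k) * / INR k))) with
    (C * sqrt (INR k) * / (INR k ^ 2)) by (field; lra).
  apply Rmult_le_compat; [apply Rabs_pos|lra|now apply H|].
  apply Rinv_le_contravar; [apply pow_lt; lra|].
  apply pow_incr. split; [lra|now apply oddR_ge].
Qed.

Lemma moderate_div_sqr_summable F : moderate F ->
  exists r, Un_cv (fun n => sum_range 1 n (fun k => F k / oddR k ^ 2)) r.
Proof.
  intros H. destruct (moderate_div_sqr F H) as [C [HC B]].
  exact (summable_of_bound _ C HC B).
Qed.

Lemma decays_div_sqr F : moderate F -> decays (fun k => F k / oddR k ^ 2).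
Proof.
  intros H. destruct (moderate_div_sqr F H) as [C [HC B]].
  exists C. split; [exact HC|]. intros k Hk. eapply Rle_trans; [now apply B|].
  apply Rmult_le_compat_l; [exact HC|]. pose proof (sqrt_ge1 k Hk).
  apply Rinv_le_contravar; [lra|]. pose proof (le_INR 1 k Hk). simpl in *. nra.
Qed.

Lemma decays_div_pow F m : decays F -> decays (fun k => F k / oddR k ^ m).
Proof.
  intros [C [HC H]]. exists C. split; [exact HC|]. intros k Hk.
  assert (1 <= oddR k ^ m).
  { apply pow_R1_Rle. pose proof (oddR_ge k Hk). pose proof (le_INR 1 k Hk). simpl in *. lra. }
  unfold Rdiv. rewrite Rabs_mult, (Rabs_pos_eq (/ _)) by (apply Rlt_le, Rinv_0_lt_compat; lra).
  eapply Rle_trans; [|apply (H k Hk)].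
  rewrite <- (Rmult_1_r (Rabs (F k))) at 2.
  apply Rmult_le_compat_l; [apply Rabs_pos|].
  rewrite <- Rinv_1. apply Rinv_le_contravar; lra.
Qed.

Lemma decays_leibniz : decays (fun k => - (-1) ^ k / oddR k).
Proof.
  exists 1. split; [lra|]. intros k Hk. pose proof (oddR_pos k Hk).
  unfold Rdiv. rewrite Rabs_mult, Rabs_Ropp, pow_1_abs, Rabs_pos_eq
    by (apply Rlt_le, Rinv_0_lt_compat; lra).
  rewrite !Rmult_1_l. pose proof (sqrt_ge1 k Hk).
  apply Rinv_le_contravar; [lra|]. eapply Rle_trans; [|now apply oddR_ge].
  rewrite <- (sqrt_sqrt (INR k)) at 2 by apply pos_INR. nra.
Qed.

(** * Leibniz' series and the limit of the kernel *)

Lemma leibniz_cv : Un_cv (fun n => sum_range 1 n (fun k => - (-1) ^ k / oddR k)) (PI / 4).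
Proof.
  assert (E : forall n, sum_range 1 (S n) (fun k => - (-1) ^ k / oddR k) = sum_f_R0 (tg_alt PI_tg) n).
  { induction n as [|n IH].
    - rewrite sum_range_S, sum_range_empty by lia. unfold tg_alt, PI_tg, oddR. simpl. field.
    - rewrite sum_range_S, IH by lia. cbn [sum_f_R0]. f_equal.
      unfold tg_alt, PI_tg, oddR. rewrite plus_INR, mult_INR, !S_INR. cbn [pow].
      pose proof (pos_INR n). simpl INR. field. lra. }
  (* [Alt_PI] is four times the sum of Leibniz' series indexed from 0, whence the shift by one in
     [E]. *)
  rewrite <- Alt_PI_eq. unfold Alt_PI. destruct exist_PI as [l Hl].
  replace (4 * l / 4) with l by field.
  intros eps He. destruct (Hl eps He) as [K HK]. exists (S K). intros n Hn.
  destruct n as [|n]; [lia|]. rewrite E. apply HK. lia.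
Qed.

Lemma kernel0_lim : Un_cv kernel0 (4 / PI).
Proof.
  destruct kernel0_cv as [l Hl].
  pose proof (kernel_toeplitz _ _ _ Hl leibniz_cv) as H.
  assert (H1 : Un_cv (fun n => sum_range 1 n (fun k => kernel n k * (- (-1) ^ k / oddR k))) 1).
  { intros eps He. exists 1%nat. intros n Hn.
    rewrite <- (represents_nil n Hn). unfold tstar_part. simpl.
    unfold R_dist. rewrite Rminus_diag, Rabs_R0. exact He. }
  pose proof (UL_sequence _ _ _ H H1) as E. pose proof PI_RGT_0.
  replace (4 / PI) with l; [exact Hl|].
  apply Rmult_eq_reg_r with (PI / 4); [|lra]. rewrite E. field. lra.
Qed.

(** * The two sides of the identity *)

(** The sum inside [V^#_{p,l}({1}^j)] without its prefactor, in a form that also covers [j = 0]. *)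
Definition chain_weight (j p l : nat) : R :=
  chsum j p l (fun ls => 2 ^ trich p ls l * tterm (repeat 1%nat j) ls).

Lemma chain_weight_0 p l : chain_weight 0 p l = 2 ^ tri p l.
Proof. unfold chain_weight. simpl. ring. Qed.

Lemma chain_weight_S j p l :
  chain_weight (S j) p l =
  sum_range l p (fun m => 2 ^ tri p m * / oddR m * chain_weight j m l).
Proof.
  unfold chain_weight. cbn [chsum]. apply sum_range_ext. intros m _.
  rewrite <- chsum_scal. apply chsum_ext. intros ls.
  cbn [trich repeat tterm]. rewrite pow_add, pow_1. ring.
Qed.

Lemma Vsharp_ones j p l : (1 <= l <= p)%nat ->
  Vsharp p l (repeat 1%nat j) = oddR p / oddR l * chain_weight j p l.
Proof.
  intros H. pose proof (oddR_pos l ltac:(lia)). destruct j as [|j].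
  - rewrite chain_weight_0. cbn [repeat Vsharp].
    destruct (Nat.eq_dec p l) as [->|E].
    + rewrite tri_refl. simpl. field. lra.
    + rewrite tri_neq by exact E. simpl. ring.
  - cbn [repeat Vsharp]. replace (Nat.leb l p) with true by (symmetry; apply Nat.leb_le; lia).
    cbn [length]. rewrite repeat_length. reflexivity.
Qed.

(** The signs [(-1)^(p+l)] and [(-1)^(l+k)] of two successive steps combine to [(-1)^(p+k)], free of
    [l]; the remaining factor [2^tri(p,l) / (2l-1)] adds [l] as a new link at the front of the
    chain. *)
Lemma iter_alt_sum j F p :
  Nat.iter (S j) alt_sum F p =
  sum_range 1 p (fun k => (-1) ^ (p + k) * chain_weight j p k * (F k / oddR k)).
Proof.
  revert p. induction j as [|j IH]; intros p.
  - change (Nat.iter 1 alt_sum F p) with (alt_sum F p). apply sum_range_ext.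
    intros k _. rewrite chain_weight_0. ring.
  - change (Nat.iter (S (S j)) alt_sum F p) with (alt_sum (Nat.iter (S j) alt_sum F) p).
    unfold alt_sum at 1.
    rewrite (sum_range_ext 1 p _ (fun l => sum_range 1 l (fun k =>
      2 ^ tri p l * (-1) ^ (p + l) / oddR l *
      ((-1) ^ (l + k) * chain_weight j l k * (F k / oddR k))))).
    + rewrite sum_range_triangle. apply sum_range_ext. intros k Hk.
      rewrite chain_weight_S, (Rmult_comm ((-1) ^ (p + k))), Rmult_assoc, Rmult_comm,
        <- sum_range_scal.
      apply sum_range_ext. intros l Hl.
      transitivity (((-1) ^ l * (-1) ^ l) * ((-1) ^ p * (-1) ^ k) * (F k / oddR k) *
        (2 ^ tri p l * / oddR l * chain_weight j l k)).
      * rewrite !pow_add. unfold Rdiv. ring.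
      * rewrite pow_m1_sqr, pow_add. ring.
    + intros l Hl. rewrite IH, sum_range_scal. unfold Rdiv. ring.
Qed.

(** * The coefficients read off from the right-hand side *)

Lemma deltaf_le2 c : (deltaf c <= 2)%nat.
Proof. destruct c as [|[|c]]; simpl; lia. Qed.

Lemma deltaf_le1 c : (1 <= c)%nat -> (deltaf c <= 1)%nat.
Proof. destruct c as [|[|c]]; simpl; lia. Qed.

(** As [c_i >= 1], [delta_i] is at most [1 + 2], so the integer exponent is a natural number. *)
Lemma rfactor_eq d a c i p l : (1 <= cext d c i)%nat -> (1 <= l)%nat ->
  rfactor d a c i p l =
  (-1) ^ (l * deltai d c i) / oddR l ^ (2 * a i + 3 - deltai d c i)
  * Vsharp p l (repeat 1%nat (cext d c i - 3)).
Proof.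
  intros Hc Hl. unfold rfactor. rewrite (pow_powerRZ (oddR l)).
  enough (E : (2 * Z.of_nat (a i) - Z.of_nat (deltai d c i) + 3)%Z =
    Z.of_nat (2 * a i + 3 - deltai d c i)) by now rewrite E.
  pose proof (deltaf_le1 _ Hc). pose proof (deltaf_le2 (cext d c (S i))).
  unfold deltai. lia.
Qed.

(* The [F] attached to the tail [{2}^a_i, c_(i+1), ..., {2}^a_d] of the index, with
   [n = d - i]: the sum over [k_(i+1), ..., k_d] given [k_i = k]. *)
Definition coef (d : nat) (a c : nat -> nat) (i n k : nat) : R :=
  - (-1) ^ (k * S (deltaf (cext d c (S i))))
  / oddR k ^ (2 * a i + 3 - deltaf (cext d c (S i)))
  * chsum n k 1 (rprod d a c (S i) k).

Lemma chsum_rprod d a c i n p hi :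
  chsum (S n) hi 1 (rprod d a c i p) =
  sum_range 1 hi (fun l => rfactor d a c i p l * chsum n l 1 (rprod d a c (S i) l)).
Proof.
  cbn [chsum rprod]. apply sum_range_ext. intros l _. apply chsum_scal.
Qed.

Lemma cext_mid d c i : (1 <= i <= d)%nat -> cext d c i = c i.
Proof.
  intros H. unfold cext. destruct (Nat.eqb_spec i 0); [lia|].
  destruct (Nat.leb_spec i d); [reflexivity|lia].
Qed.

Lemma cext_last d c : cext d c (S d) = 0%nat.
Proof. unfold cext. now rewrite (proj2 (Nat.leb_gt (S d) d)) by lia. Qed.

Lemma coef_last d a c k : (1 <= k)%nat ->
  coef d a c d 0 k = - (-1) ^ k / oddR k / oddR k ^ (2 * a d).
Proof.
  intros Hk. pose proof (oddR_pos k Hk). unfold coef. rewrite cext_last. cbn [deltaf chsum rprod].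
  replace (2 * a d + 3 - 2)%nat with (2 * a d + 1)%nat by lia.
  replace (k * 3)%nat with (k * 2 + k)%nat by lia.
  rewrite !pow_add, pow_m1_double, pow_1.
  generalize (pow_nonzero (oddR k) (2 * a d) ltac:(lra)).
  generalize (oddR k ^ (2 * a d)). intros. field. lra.
Qed.

(** Here [V^#] has the empty index. Its factor [(2k-1)/(2l-1)] lowers the power of [2k-1] by one and
    supplies the power of [2l-1] lost to [delta(1) = 1]; the sign in [k] is [(-1)^(2k)]. *)
Lemma coef_one d a c i n k : cext d c (S i) = 1%nat -> (1 <= k)%nat ->
  coef d a c i (S n) k =
  double_sum (coef d a c (S i) n) k / oddR k / oddR k ^ (2 * a i).
Proof.
  intros Hc Hk. pose proof (oddR_pos k Hk) as Pk.
  unfold coef at 1. rewrite chsum_rprod, Hc. cbn [deltaf].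
  transitivity (/ (oddR k * oddR k ^ (2 * a i)) * double_sum (coef d a c (S i) n) k);
    [|rewrite Rinv_mult; unfold Rdiv; ring].
  unfold double_sum.
  rewrite <- !sum_range_scal. apply sum_range_ext. intros l Hl.
  pose proof (oddR_pos l ltac:(lia)) as Pl.
  rewrite rfactor_eq, Hc, Vsharp_ones by lia. cbn [Nat.sub]. rewrite chain_weight_0.
  unfold coef, deltai. rewrite Hc. cbn [deltaf].
  pose proof (deltaf_le2 (cext d c (S (S i)))).
  set (e := deltaf (cext d c (S (S i)))) in *.
  replace (2 * a (S i) + 3 - e)%nat with (2 * a (S i) + 3 - (1 + e) + 1)%nat by lia.
  replace (2 * a i + 3 - 1)%nat with (2 * a i + 2)%nat by lia.
  rewrite pow_m1_double, (pow_add _ (2 * a i) 2), (pow_add _ _ 1).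
  generalize (pow_nonzero (oddR k) (2 * a i) ltac:(lra)) (pow_nonzero (oddR l) (2 * a (S i) + 3 - (1 + e)) ltac:(lra)).
  generalize (oddR k ^ (2 * a i)) (oddR l ^ (2 * a (S i) + 3 - (1 + e))).
  change (S e) with (1 + e)%nat.
  generalize ((-1) ^ (l * (1 + e))) (chsum n l 1 (rprod d a c (S (S i)) l)) (2 ^ tri k l).
  intros. field. lra.
Qed.

(** The [c - 3 = j] ones in [V^#] are the links created by [c - 2] iterations of [alt_sum]. *)
Lemma coef_ge3 d a c i n j k : cext d c (S i) = S (S (S j)) -> (1 <= k)%nat ->
  coef d a c i (S n) k =
  Nat.iter (S j) alt_sum (coef d a c (S i) n) k / oddR k ^ 2 / oddR k ^ (2 * a i).
Proof.
  intros Hc Hk. pose proof (oddR_pos k Hk) as Pk.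
  rewrite iter_alt_sum.
  unfold coef at 1. rewrite chsum_rprod, Hc. cbn [deltaf].
  match goal with |- _ = ?s / _ / _ =>
    transitivity (/ (oddR k ^ 2 * oddR k ^ (2 * a i)) * s);
    [|rewrite Rinv_mult; unfold Rdiv; ring]
  end.
  rewrite <- !sum_range_scal. apply sum_range_ext. intros l Hl.
  pose proof (oddR_pos l ltac:(lia)) as Pl.
  rewrite rfactor_eq, Hc, Vsharp_ones by lia.
  replace (S (S (S j)) - 3)%nat with j by lia.
  unfold coef, deltai. rewrite Hc. cbn [deltaf Nat.add].
  set (e := deltaf (cext d c (S (S i)))) in *.
  replace (2 * a i + 3 - 0)%nat with (2 * a i + 3)%nat by lia.
  replace (l * S e)%nat with (l + l * e)%nat by lia.
  rewrite Nat.mul_1_r, (pow_add _ k l), (pow_add _ l (l * e)), (pow_add _ (2 * a i) 3).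
  (* Of the two inserted signs [(-1)^l], one joins [(-1)^k] to form the sign of [alt_sum], the other
     completes [(-1)^(l*e)] to the sign in [coef]. *)
  transitivity (((-1) ^ l * (-1) ^ l) * (- (-1) ^ k / (oddR k ^ (2 * a i) * oddR k ^ 3) *
    ((-1) ^ (l * e) / oddR l ^ (2 * a (S i) + 3 - e) * (oddR k / oddR l * chain_weight j k l) *
    chsum n l 1 (rprod d a c (S (S i)) l)))); [rewrite pow_m1_sqr; ring|].
  generalize (pow_nonzero (oddR k) (2 * a i) ltac:(lra)) (pow_nonzero (oddR l) (2 * a (S i) + 3 - e) ltac:(lra)).
  generalize (oddR k ^ (2 * a i)) (oddR l ^ (2 * a (S i) + 3 - e)).
  generalize ((-1) ^ (l * e)) ((-1) ^ l) ((-1) ^ k) (chsum n l 1 (rprod d a c (S (S i)) l))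
    (chain_weight j k l).
  intros. field. lra.
Qed.

Definition blocks (a c : nat -> nat) (i n : nat) : list nat :=
  concat (map (fun i => c i :: repeat 2%nat (a i)) (seq i n)).

(** Induction from the inner end of the index. [G] belongs to the tail stripped of its leading twos;
    this keeps visible the division by [(2k-1)^(2 a_0)] that yields summability when [a_0 > 0]. *)
Lemma coef_represents d a c
  (hc : forall i : nat, (1 <= i <= d)%nat -> (1 <= c i)%nat /\ c i <> 2%nat) :
  forall n i, (i + n)%nat = d ->
  exists G, represents (blocks a c (S i) n) G /\ decays G /\
    forall k, (1 <= k)%nat -> coef d a c i n k = G k / oddR k ^ (2 * a i).
Proof.
  induction n as [|n IH]; intros i Hi.
  - rewrite Nat.add_0_r in Hi. subst i.
    exists (fun k => - (-1) ^ k / oddR k).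
    split; [exact represents_nil|]. split; [exact decays_leibniz|].
    intros k Hk. now apply coef_last.
  - destruct (IH (S i) ltac:(lia)) as [G [Rp [Dc E]]].
    assert (Rp' : represents (repeat 2%nat (a (S i)) ++ blocks a c (S (S i)) n)
      (coef d a c (S i) n)).
    { eapply represents_ext; [|apply represents_twos, Rp].
      intros k Hk. symmetry. now apply E. }
    assert (Dc' : decays (coef d a c (S i) n)).
    { eapply decays_ext; [|apply (decays_div_pow G (2 * a (S i))), Dc].
      intros k Hk. symmetry. now apply E. }
    change (blocks a c (S i) (S n)) with
      (c (S i) :: (repeat 2%nat (a (S i)) ++ blocks a c (S (S i)) n)).
    destruct (hc (S i) ltac:(lia)) as [H1 H2].
    pose proof (cext_mid d c (S i) ltac:(lia)) as Ec.
    destruct (c (S i)) as [|[|[|j]]]; try lia.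
    + exists (fun p => double_sum (coef d a c (S i) n) p / oddR p).
      split; [now apply represents_cons_one|]. split; [now apply decays_double_sum|].
      intros k Hk. now apply coef_one.
    + exists (fun p => Nat.iter (S j) alt_sum (coef d a c (S i) n) p / oddR p ^ 2).
      split; [now apply (represents_cons_ge2 (S j))|]. split.
      * now apply decays_div_sqr, moderate_iter_alt_sum, decays_moderate.
      * intros k Hk. now apply coef_ge3.
Qed.

Lemma coef_decays d a c
  (hc : forall i : nat, (1 <= i <= d)%nat -> (1 <= c i)%nat /\ c i <> 2%nat) n i :
  (i + n)%nat = d -> decays (coef d a c i n).
Proof.
  intros Hi. destruct (coef_represents d a c hc n i Hi) as [G [_ [Dc E]]].
  eapply decays_ext; [|apply (decays_div_pow G (2 * a i)), Dc].
  intros k Hk. symmetry. now apply E.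
Qed.

Lemma Un_cv_ext (u v : nat -> R) l : (forall n, (1 <= n)%nat -> u n = v n) ->
  Un_cv u l -> Un_cv v l.
Proof.
  intros E H eps He. destruct (H eps He) as [K HK]. exists (S K). intros n Hn.
  rewrite <- E by lia. apply HK. lia.
Qed.

(** Decay [O(k^(-1/2))] is too weak. A leading entry 2 or [c_1 >= 3] exhibits the coefficient as a
    moderate function over [(2k-1)^2]; for the empty index the series is that of Leibniz. *)
Lemma coef_summable d a c
  (hc : forall i : nat, (1 <= i <= d)%nat -> (1 <= c i)%nat /\ c i <> 2%nat)
  (hc1 : a O = O -> (1 <= d)%nat -> (3 <= c 1%nat)%nat) :
  exists r, Un_cv (fun n => sum_range 1 n (coef d a c 0 d)) r.
Proof.
  assert (X : forall G : nat -> R, (forall k, (1 <= k)%nat -> G k = coef d a c 0 d k) ->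
    (exists r, Un_cv (fun n => sum_range 1 n G) r) ->
    exists r, Un_cv (fun n => sum_range 1 n (coef d a c 0 d)) r).
  { intros G E [r H]. exists r. eapply Un_cv_ext; [|exact H].
    intros n _. apply sum_range_ext. intros k Hk. apply E. lia. }
  destruct (a 0%nat) as [|a0] eqn:Ea.
  - destruct d as [|d].
    + eapply X; [|exists (PI / 4); exact leibniz_cv].
      intros k Hk. rewrite coef_last, Ea by exact Hk. simpl. field.
      pose proof (oddR_pos k Hk). lra.
    + specialize (hc1 eq_refl ltac:(lia)).
      pose proof (coef_decays _ a c hc d 1 eq_refl) as Dc.
      pose proof (cext_mid (S d) c 1 ltac:(lia)) as E.
      destruct (c 1%nat) as [|[|[|j]]]; try lia.
      eapply X; [|apply moderate_div_sqr_summable, (moderate_iter_alt_sum (S j)),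
        decays_moderate, Dc].
      intros k Hk. rewrite (coef_ge3 _ _ _ 0 d j k E Hk), Ea.
      cbn [Nat.mul Nat.add]. rewrite (pow_O (oddR k)). unfold Rdiv. now rewrite Rinv_1, Rmult_1_r.
  - destruct (coef_represents _ a c hc d 0 eq_refl) as [G [_ [Dc E]]].
    eapply X; [|apply moderate_div_sqr_summable, decays_moderate,
      (decays_div_pow G (2 * a0)), Dc].
    intros k Hk. rewrite (E k Hk), Ea. pose proof (oddR_pos k Hk).
    replace (2 * S a0)%nat with (2 * a0 + 2)%nat by lia.
    rewrite (pow_add _ (2 * a0) 2).
    generalize (pow_nonzero (oddR k) (2 * a0) ltac:(lra)).
    generalize (oddR k ^ (2 * a0)). intros. field. lra.
Qed.

Lemma rhs_part_coef d a c N : rhs_part d a c N = 2 * sum_range 1 N (coef d a c 0 d).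
Proof.
  unfold rhs_part. rewrite chsum_rprod, <- sum_range_scal. apply sum_range_ext.
  intros k Hk. pose proof (oddR_pos k ltac:(lia)).
  assert (E0 : cext d c 0 = 1%nat) by reflexivity.
  rewrite rfactor_eq, E0 by (rewrite ?E0; lia). cbn [Nat.sub repeat Vsharp].
  rewrite tri_neq by lia.
  unfold coef, deltai. rewrite E0. cbn [deltaf].
  pose proof (deltaf_le2 (cext d c 1)). set (e := deltaf (cext d c 1)) in *.
  replace (2 * a 0%nat + 3 - e)%nat with (2 * a 0%nat + 3 - (1 + e) + 1)%nat by lia.
  rewrite (pow_add _ _ 1), pow_1, (pow_1 (oddR k)).
  (* With [k_{-1} = 0], [V^#_{0,k}] is [-2 / (2k-1)]: the source of the factor 2 and of the minus
     sign in [coef]. *)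
  replace (oddR 0) with (-1) by (unfold oddR; simpl; ring).
  change (S e) with (1 + e)%nat.
  generalize (pow_nonzero (oddR k) (2 * a 0%nat + 3 - (1 + e)) ltac:(lra)).
  generalize (oddR k ^ (2 * a 0%nat + 3 - (1 + e))) ((-1) ^ (k * (1 + e))).
  intros. field. lra.
Qed.

Theorem theorem3p3 (d : nat) (a c : nat -> nat)
  (hc : forall i : nat, (1 <= i <= d)%nat -> (1 <= c i)%nat /\ c i <> 2%nat)
  (hc1 : a O = O -> (1 <= d)%nat -> (3 <= c 1%nat)%nat) :
  exists L : R,
    Un_cv (tstar_part (index_of d a c)) L /\
    Un_cv (fun N => 2 / PI * rhs_part d a c N) L.
Proof.
  destruct (coef_summable d a c hc hc1) as [r Hr].
  destruct (coef_represents d a c hc d 0 eq_refl) as [G [Rp [_ E]]].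
  (* The limit is that of the kernel times the sum of the coefficients; on the other side [4 / PI]
     is [2 / PI] times the 2 of [rhs_part_coef]. *)
  pose proof PI_RGT_0. exists (4 / PI * r). split.
  - eapply Un_cv_ext; [|apply kernel_toeplitz; [apply kernel0_lim | exact Hr]].
    intros n Hn. symmetry.
    change (index_of d a c) with (repeat 2%nat (a 0%nat) ++ blocks a c 1 d).
    rewrite (represents_twos (a 0%nat) _ _ Rp n Hn).
    apply sum_range_ext. intros k Hk. now rewrite E by lia.
  - eapply Un_cv_ext; [|apply (CV_mult (fun _ => 4 / PI)); [|exact Hr]].
    + intros n _. cbv beta. rewrite rhs_part_coef. field. lra.
    + intros eps He. exists O. intros. unfold R_dist. rewrite Rminus_diag, Rabs_R0. exact He.
Qed.
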